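(* Let $(R,\mathfrak m_R,\mathsf k)$ and $(S,\mathfrak m_S,\mathsf k)$ be Gorenstein Artin local rings different from $\mathsf k$, and let $Q=R\#_{\mathsf k}S$ be a connected sum. If $\ell\ell(R)\ne\ell\ell(S)$, then the associated graded ring $\mathrm{gr}(Q)$ is a fibre product over $\mathsf k$. Moreover, still assuming $\ell\ell(R)\neq\ell\ell(S)$, if $R$ and $S$ are standard graded $\mathsf k$-algebras with $\ell\ell(R),\ell\ell(S)\ge2$, then the nontrivial connected sum $R\#_{\mathsf k}S$ is not standard graded.
   Context: For an Artinian local ring $(T,\mathfrak m,\mathsf k)$: $\mathrm{soc}(T)=\mathrm{ann}_T(\mathfrak m)$, the Loewy length is $\ell\ell(T)=\max\{n:\mathfrak m^n\ne0\}$, and $\mathrm{gr}(T)=\bigoplus_{i\ge0}\mathfrak m^i/\mathfrak m^{i+1}$ is the associated graded ring. A graded $\mathsf k$-algebra $G=\bigoplus_{i\ge0}G_i$ with $G_0=\mathsf k$ is standard graded if $\bigoplus_{i\ge1}G_i$ is generated by $G_1$; an Artinian local ring is called standard graded if it is isomorphic to such an algebra (equivalently, it is then isomorphic to its associated graded ring). The fibre product of local rings (or graded $\mathsf k$-algebras) $R,S$ with common residue field $\mathsf k$ is $R\times_{\mathsf k}S=\{(a,b)\in R\times S:\pi_R(a)=\pi_S(b)\}$, where $\pi_R,\pi_S$ are the natural projections onto $\mathsf k$. If $R,S$ are Gorenstein Artin local rings different from $\mathsf k$, with $\mathrm{soc}(R)=\langle\delta_R\rangle$, $\mathrm{soc}(S)=\langle\delta_S\rangle$,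 a connected sum is $R\#_{\mathsf k}S=(R\times_{\mathsf k}S)/\langle(\delta_R,0)-(0,\delta_S)\rangle$; it depends on the choice of $\delta_R,\delta_S$, and the statement concerns any such choice. A connected sum is nontrivial if it is isomorphic to neither $R$ nor $S$. *)

(* Defs.v *)
From HB Require Import structures.
From mathcomp Require Import all_boot all_order all_algebra ring_quotient.
From mathcomp Require Import boolp classical_sets.

Set Implicit Arguments.
Unset Strict Implicit.
Unset Printing Implicit Defensive.

Import GRing.Theory.
Local Open Scope ring_scope.
Local Open Scope classical_set_scope.
Local Open Scope quotient_scope.

Definition ring_isom (A B : pzRingType) : Prop :=
  exists f : {rmorphism A -> B}, bijective f.

Section Ideals.
Variable T : comNzRingType.
Implicit Types (I J A : set T).

Definition is_ideal I : Prop :=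
  [/\ I 0, (forall x y, I x -> I y -> I (x + y)) & forall a x, I x -> I (a * x)].

Definition ideal_gen A : set T :=
  [set x | forall I, is_ideal I -> A `<=` I -> I x].

Definition ideal_mul I J : set T :=
  ideal_gen [set x | exists a b, [/\ I a, J b & x = a * b]].

Fixpoint ideal_pow I n : set T :=
  if n is n'.+1 then ideal_mul (ideal_pow I n') I else setT.

Definition artinian : Prop :=
  forall I : nat -> set T, (forall n, is_ideal (I n)) ->
    (forall n, I n.+1 `<=` I n) ->
    exists N, forall n, (N <= n)%N -> I n = I N.

Lemma ideal_gen_ideal A : is_ideal (ideal_gen A).
Proof.
split=> [I []//|x y Ax Ay I idI AI|a x Ax I idI AI].
- by case: (idI) => _ D _; apply: D; [apply: Ax|apply: Ay].
- by case: (idI) => _ _; apply; apply: Ax.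
Qed.

Lemma sub_ideal_gen A : A `<=` ideal_gen A.
Proof. by move=> x Ax I _; apply. Qed.

Lemma idealN I x : is_ideal I -> I x -> I (- x).
Proof. by case=> _ _ M Ix; rewrite -mulN1r; apply: M. Qed.

Lemma idealB I x y : is_ideal I -> I x -> I y -> I (x - y).
Proof. by move=> idI Ix Iy; case: (idI) => _ D _; apply: D => //; apply: idealN. Qed.

Lemma ideal_sum I (J : Type) (r : seq J) (P : pred J) (F : J -> T) :
  is_ideal I -> (forall j, P j -> I (F j)) -> I (\sum_(j <- r | P j) F j).
Proof. by case=> I0 ID _ IF; apply: (big_ind I). Qed.

Lemma ideal_pow_ideal I n : is_ideal (ideal_pow I n).
Proof. by case: n => [|n] /=; [split|apply: ideal_gen_ideal]. Qed.

Lemma ideal_powM I i j a b :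
  ideal_pow I i a -> ideal_pow I j b -> ideal_pow I (i + j) (a * b).
Proof.
move=> Ia; elim: j b => [|j IH] b.
  by rewrite addn0 mulrC => _; case: (ideal_pow_ideal I i) => _ _; apply.
move=> /= Ib; rewrite addnS.
have [P0 PD PM] := ideal_pow_ideal I (i + j).+1.
apply: (Ib [set x | ideal_pow I (i + j).+1 (a * x)]).
  split=> [|x y|c x] /=; first by rewrite mulr0.
    by rewrite mulrDr; apply: PD.
  by rewrite mulrCA; apply: PM.
move=> _ [c [d [Ic Id ->]]]; apply: sub_ideal_gen.
by exists (a * c), d; split; rewrite ?mulrA //; apply: IH.
Qed.

Lemma ideal_powS I n : ideal_pow I n.+1 `<=` ideal_pow I n.
Proof.
move=> x; apply; first exact: ideal_pow_ideal.
move=> _ [a [b [Ia _ ->]]]; rewrite mulrC.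
by case: (ideal_pow_ideal I n) => _ _; apply.
Qed.

Lemma ideal_pow1 I : is_ideal I -> ideal_pow I 1 `<=` I.
Proof.
by move=> idI x; apply=> // _ [a [b [_ Ib ->]]]; case: idI => _ _; apply.
Qed.

End Ideals.

Lemma ker_ideal (T : comNzRingType) (k : fieldType) (f : {rmorphism T -> k}) :
  is_ideal [set x | f x = 0].
Proof.
split=> [|x y /= fx fy|a x /= fx]; first exact: rmorph0.
- by rewrite rmorphD fx fy addr0.
- by rewrite rmorphM fx mulr0.
Qed.

(* [localRing k] is the triple (T, m, k): [res] is the projection T -> T/m = k,
   and every element outside m = ker res is invertible. *)
Record localRing (k : fieldType) := LocalRing {
  local_ring :> comNzRingType;
  res : {rmorphism local_ring -> k};
  res_surj : forall c, exists x, res x = c;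
  res_unit : forall x, res x != 0 -> exists y, y * x = 1
}.

(* The identification of G_0 with k is given by [aug], the projection of G onto
   k; it is bijective on G_0 and kills G_i for i > 0. *)
Record gradedAlgebra (k : fieldType) := GradedAlgebra {
  graded_ring :> comNzRingType;
  aug : {rmorphism graded_ring -> k};
  gcomp : nat -> set graded_ring;
  gcomp0 : forall i, gcomp i 0;
  gcompB : forall i x y, gcomp i x -> gcomp i y -> gcomp i (x - y);
  gcomp1 : gcomp 0%N 1;
  gcompM : forall i j x y, gcomp i x -> gcomp j y -> gcomp (i + j)%N (x * y);
  gcomp_span : forall x, exists n (f : nat -> graded_ring),
    (forall i, gcomp i (f i)) /\ x = \sum_(i < n) f i;
  gcomp_free : forall n (f : nat -> graded_ring),
    (forall i, gcomp i (f i)) -> \sum_(i < n) f i = 0 ->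
    forall i, (i < n)%N -> f i = 0;
  aug_bij0 : forall c, exists! x, gcomp 0%N x /\ aug x = c;
  aug_gt0 : forall i x, (0 < i)%N -> gcomp i x -> aug x = 0
}.

Section LocalRingTheory.
Variables (k : fieldType) (T : localRing k).

Definition maxideal : set T := [set x | res T x = 0].

Definition socle : set T := [set x | forall y, maxideal y -> x * y = 0].

(* The socle is annihilated by the maximal ideal, so this says that it is a
   one-dimensional k-vector space. *)
Definition gorenstein : Prop :=
  exists d : T, d <> 0 /\ socle = ideal_gen [set d].

(* The value is 0 by convention when the maximum does not exist, which does not
   happen when T is Artinian. *)
Definition loewy_length : nat :=
  xget 0%N [set n | ideal_pow maxideal n <> [set 0] /\
    forall j, ideal_pow maxideal j <> [set 0] -> (j <= n)%N].

End LocalRingTheory.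
Arguments maxideal {k} T.
Arguments socle {k} T.

Section GradedTheory.
Variable k : fieldType.
Implicit Types G H : gradedAlgebra k.

Definition irrelevant_ideal G : set G :=
  [set x | exists n (f : nat -> G),
    (forall i, gcomp i.+1 (f i)) /\ x = \sum_(i < n) f i].

Arguments irrelevant_ideal : clear implicits.

Definition standard_graded_algebra G : Prop :=
  irrelevant_ideal G = ideal_gen (@gcomp k G 1%N).

Definition graded_isom G H : Prop :=
  exists f : {rmorphism G -> H}, [/\ bijective f,
    forall i x, gcomp i x <-> gcomp i (f x) & forall x, aug H (f x) = aug G x].

Definition standard_graded (T : localRing k) : Prop :=
  exists G : gradedAlgebra k, standard_graded_algebra G /\ ring_isom T G.

End GradedTheory.

Section FibreProduct.
Variables (k : fieldType) (A B : comNzRingType).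
Variables (f : {rmorphism A -> k}) (g : {rmorphism B -> k}).

Definition fibprod_pred : {pred A * B} := fun x => f x.1 == g x.2.

Lemma fibprod_subring : subring_closed fibprod_pred.
Proof.
split=> [|x y|x y]; rewrite /fibprod_pred !unfold_in /= ?rmorph1 //.
- by move=> /eqP xE /eqP yE; rewrite !rmorphB xE yE.
- by move=> /eqP xE /eqP yE; rewrite !rmorphM xE yE.
Qed.

HB.instance Definition _ :=
  GRing.isSubringClosed.Build (A * B)%type fibprod_pred fibprod_subring.

Record fibprod := FibProd { fibprod_val : A * B; _ : fibprod_val \in fibprod_pred }.

HB.instance Definition _ := [isSub for fibprod_val].
HB.instance Definition _ := [Choice of fibprod by <:].
HB.instance Definition _ := [SubChoice_isSubComNzRing of fibprod by <:].

Lemma fibprodP (x : fibprod) : f (fibprod_val x).1 = g (fibprod_val x).2.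
Proof. by case: x => x /= /eqP. Qed.

Definition mk_fibprod (a : A) (b : B) (e : f a = g b) : fibprod :=
  @FibProd (a, b) (introT eqP e).

Definition fibprod_res (x : fibprod) : k := f (fibprod_val x).1.

Lemma fibprod_res_zmod : zmod_morphism fibprod_res.
Proof. by move=> x y; rewrite /fibprod_res /= rmorphB. Qed.

Lemma fibprod_res_monoid : monoid_morphism fibprod_res.
Proof. by split=> [|x y]; rewrite /fibprod_res /= ?rmorph1 ?rmorphM. Qed.

HB.instance Definition _ :=
  GRing.isZmodMorphism.Build fibprod k fibprod_res fibprod_res_zmod.
HB.instance Definition _ :=
  GRing.isMonoidMorphism.Build fibprod k fibprod_res fibprod_res_monoid.

End FibreProduct.

Section FibreProductLocal.
Variables (k : fieldType) (R S : localRing k).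

Local Notation P := (fibprod (res R) (res S)).
Local Notation resP := (@fibprod_res k R S (res R) (res S)).

Lemma fibprod_res_surj c : exists x : P, resP x = c.
Proof.
have [a ac] := res_surj R c; have [b bc] := res_surj S c.
by exists (mk_fibprod (etrans ac (esym bc))).
Qed.

Lemma fibprod_res_unit (x : P) : resP x != 0 -> exists y, y * x = 1.
Proof.
move=> x0; have [a ax] := res_unit x0.
have x0' : res S (fibprod_val x).2 != 0 by rewrite -fibprodP.
have [b bx] := res_unit x0'.
have e : res R a = res S b.
  apply: (mulIf x0'); rewrite -{1}fibprodP -!rmorphM ax bx.
  by rewrite !rmorph1.
exists (mk_fibprod e); apply: val_inj => /=.
by case: (fibprod_val x) ax bx => u v /= ax bx; congr (_, _).
Qed.

Definition fibprod_local : localRing k :=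
  @LocalRing k P resP fibprod_res_surj fibprod_res_unit.

End FibreProductLocal.

Section FibreProductGraded.
Variables (k : fieldType) (A B : gradedAlgebra k).

Local Notation P := (fibprod (aug A) (aug B)).
Local Notation augP := (@fibprod_res k A B (aug A) (aug B)).

Definition fibprod_gcomp (i : nat) : set P :=
  [set x | gcomp i (fibprod_val x).1 /\ gcomp i (fibprod_val x).2].

Lemma fibprod_val_sum n (h : nat -> P) :
  fibprod_val (\sum_(i < n) h i) =
  (\sum_(i < n) (fibprod_val (h i)).1, \sum_(i < n) (fibprod_val (h i)).2).
Proof.
elim: n => [|n IH]; first by rewrite !big_ord0.
by rewrite !big_ord_recr /= -[LHS]/(fibprod_val _ + fibprod_val _) IH.
Qed.

Lemma fibprod_gcomp0 i : fibprod_gcomp i 0.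
Proof. by split; apply: gcomp0. Qed.

Lemma fibprod_gcompB i x y :
  fibprod_gcomp i x -> fibprod_gcomp i y -> fibprod_gcomp i (x - y).
Proof. by move=> [? ?] [? ?]; split; apply: gcompB. Qed.

Lemma fibprod_gcomp1 : fibprod_gcomp 0%N 1.
Proof. by split; apply: gcomp1. Qed.

Lemma fibprod_gcompM i j x y :
  fibprod_gcomp i x -> fibprod_gcomp j y -> fibprod_gcomp (i + j)%N (x * y).
Proof. by move=> [? ?] [? ?]; split; apply: gcompM. Qed.

Lemma gcomp_pad (G : gradedAlgebra k) n N (h : nat -> G) :
    (n <= N)%N -> (forall i, gcomp i (h i)) ->
  exists h' : nat -> G, (forall i, gcomp i (h' i)) /\
    \sum_(i < n) h i = \sum_(i < N) h' i.
Proof.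
move=> nN hh; exists (fun i => if (i < n)%N then h i else 0); split=> [i|].
  by case: ifP => // _; apply: gcomp0.
by rewrite -big_mkcond (big_ord_widen _ h nN).
Qed.

Lemma aug_sum (G : gradedAlgebra k) n (h : nat -> G) :
  (forall i, gcomp i (h i)) -> aug G (\sum_(i < n.+1) h i) = aug G (h 0%N).
Proof.
move=> hh; rewrite big_ord_recl rmorphD rmorph_sum big1 ?addr0 // => i _.
exact: (aug_gt0 _ (hh _)).
Qed.

Lemma fibprod_gcomp_span (x : P) : exists n (h : nat -> P),
  (forall i, fibprod_gcomp i (h i)) /\ x = \sum_(i < n) h i.
Proof.
have [n [a [aP xa]]] := gcomp_span (fibprod_val x).1.
have [m [b [bP xb]]] := gcomp_span (fibprod_val x).2.
have [a' [a'P Ea]] := gcomp_pad (leq_trans (leq_maxl n m) (leqnSn _)) aP.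
have [b' [b'P Eb]] := gcomp_pad (leq_trans (leq_maxr n m) (leqnSn _)) bP.
rewrite {}Ea in xa; rewrite {}Eb in xb.
have e i : aug A (a' i) = aug B (b' i).
  case: i => [|i]; last by rewrite (aug_gt0 _ (a'P _)) ?(aug_gt0 _ (b'P _)).
  by have := fibprodP x; rewrite xa xb !aug_sum.
exists (maxn n m).+1, (fun i => mk_fibprod (e i)); split=> [i|]; first by split.
apply: val_inj; rewrite [RHS](fibprod_val_sum _ (fun i => mk_fibprod (e i))) /=.
by rewrite -xa -xb; case: (fibprod_val x).
Qed.

Lemma fibprod_gcomp_free n (h : nat -> P) :
    (forall i, fibprod_gcomp i (h i)) -> \sum_(i < n) h i = 0 ->
  forall i, (i < n)%N -> h i = 0.
Proof.
move=> hP /(congr1 (@fibprod_val _ _ _ _ _)); rewrite fibprod_val_sum => -[ha hb].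
move=> i ltin; apply: val_inj => /=.
have := @gcomp_free k A n (fun i => (fibprod_val (h i)).1).
move=> /(_ (fun i => (hP i).1) ha i ltin) ea.
have := @gcomp_free k B n (fun i => (fibprod_val (h i)).2).
move=> /(_ (fun i => (hP i).2) hb i ltin) eb.
by case: (fibprod_val (h i)) ea eb => u v /= -> ->.
Qed.

Lemma fibprod_aug_bij0 c : exists! x, fibprod_gcomp 0%N x /\ augP x = c.
Proof.
have [a [[a0 ac] ua]] := aug_bij0 A c.
have [b [[b0 bc] ub]] := aug_bij0 B c.
exists (mk_fibprod (etrans ac (esym bc))); split; first by [].
move=> x [[xa xb] xc]; apply: val_inj => /=.
have -> : a = (fibprod_val x).1 by apply: ua.
have -> : b = (fibprod_val x).2 by apply: ub; split=> //; rewrite -fibprodP.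
by case: (fibprod_val x).
Qed.

Lemma fibprod_aug_gt0 i x : (0 < i)%N -> fibprod_gcomp i x -> augP x = 0.
Proof. by move=> i0 [xa _]; apply: (aug_gt0 i0). Qed.

Definition fibprod_graded : gradedAlgebra k :=
  @GradedAlgebra k P augP fibprod_gcomp fibprod_gcomp0 fibprod_gcompB
    fibprod_gcomp1 fibprod_gcompM fibprod_gcomp_span fibprod_gcomp_free fibprod_aug_bij0
    fibprod_aug_gt0.

End FibreProductGraded.

(* The hypotheses are arguments of the predicate so that the ideal structure
   declared below can be inferred from it. *)
Definition quot_pred (k : fieldType) (T : localRing k) (I : set T)
    (_ : is_ideal I) (_ : I `<=` maxideal T) : {pred T} :=
  fun x => `[< I x >].

Lemma quot_idealr (k : fieldType) (T : localRing k) (I : set T)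
  (idI : is_ideal I) (Im : I `<=` maxideal T) :
  idealr_closed (quot_pred idI Im).
Proof.
have [I0 ID IM] := idI.
split; rewrite ?unfold_in; first exact/asboolP.
  by apply/negP => /asboolP /Im; rewrite /maxideal /= rmorph1; apply/eqP/oner_neq0.
by move=> a x y /asboolP Ix /asboolP Iy; apply/asboolP/ID => //; apply: IM.
Qed.

HB.instance Definition _ (k : fieldType) (T : localRing k) (I : set T)
  (idI : is_ideal I) (Im : I `<=` maxideal T) :=
  isIdealr.Build T (quot_pred idI Im) (quot_idealr idI Im).

Section QuotientLocalRing.
Variables (k : fieldType) (T : localRing k) (I : set T).
Hypotheses (idI : is_ideal I) (Im : I `<=` maxideal T).

Local Notation Q := {ideal_quot (quot_pred idI Im)}.

Definition quot_res (x : Q) : k := res T (repr x).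

Lemma quot_resE (x : T) : quot_res (\pi_Q x) = res T x.
Proof.
apply/eqP; rewrite /quot_res -subr_eq0 -rmorphB; apply/eqP/Im/asboolP.
have /eqP : \pi_Q (repr (\pi_Q x)) = \pi_Q x by rewrite reprK.
by rewrite -Quotient.idealrBE unfold_in.
Qed.

Lemma quot_res_zmod : zmod_morphism quot_res.
Proof.
by move=> x y; rewrite -[x]reprK -[y]reprK -rmorphB !quot_resE rmorphB.
Qed.

Lemma quot_res_monoid : monoid_morphism quot_res.
Proof.
split=> [|x y]; first by rewrite -(rmorph1 \pi_Q) quot_resE rmorph1.
by rewrite -[x]reprK -[y]reprK -rmorphM !quot_resE rmorphM.
Qed.

HB.instance Definition _ :=
  GRing.isZmodMorphism.Build Q k quot_res quot_res_zmod.
HB.instance Definition _ :=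
  GRing.isMonoidMorphism.Build Q k quot_res quot_res_monoid.

Lemma quot_res_surj c : exists x : Q, quot_res x = c.
Proof. by have [x xc] := res_surj T c; exists (\pi_Q x); rewrite quot_resE. Qed.

Lemma quot_res_unit (x : Q) : quot_res x != 0 -> exists y, y * x = 1.
Proof.
rewrite -[x]reprK quot_resE => /res_unit[y yx].
by exists (\pi_Q y); rewrite -rmorphM yx rmorph1.
Qed.

Definition quot_local : localRing k :=
  @LocalRing k Q quot_res quot_res_surj quot_res_unit.

End QuotientLocalRing.

Lemma socle_maxideal (k : fieldType) (T : localRing k) (d : T) :
  ~ ring_isom T k -> socle T = ideal_gen [set d] -> res T d = 0.
Proof.
move=> Tk Td; apply: contrapT => /eqP /res_unit[y yd]; apply: Tk.
have dP : socle T d by rewrite Td; apply: sub_ideal_gen.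
exists (res T : {rmorphism T -> k}).
have inj : injective (res T).
  move=> x z /eqP; rewrite -subr_eq0 -rmorphB => /eqP xz.
  apply/eqP; rewrite -subr_eq0 -[_ - _]mul1r -yd -mulrA.
  by rewrite (dP _ xz) mulr0.
have [h hP] := choice (res_surj T).
by exists h => x //; apply: inj; rewrite hP.
Qed.

Section ConnectedSum.
Variables (k : fieldType) (R S : localRing k) (dR : R) (dS : S).
Hypotheses (nR : ~ ring_isom R k) (nS : ~ ring_isom S k).
Hypotheses (hR : socle R = ideal_gen [set dR])
           (hS : socle S = ideal_gen [set dS]).

Local Notation P := (fibprod_local R S).

Lemma csum_inlP : res R dR = res S 0.
Proof. by rewrite (socle_maxideal nR hR) rmorph0. Qed.

Lemma csum_inrP : res R 0 = res S dS.
Proof. by rewrite (socle_maxideal nS hS) rmorph0. Qed.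

Definition csum_ideal : set P :=
  ideal_gen [set mk_fibprod csum_inlP - mk_fibprod csum_inrP : P].

Lemma csum_ideal_max : csum_ideal `<=` maxideal P.
Proof.
move=> x; apply; first exact: ker_ideal.
move=> _ ->; rewrite /maxideal /= rmorphB /= /fibprod_res /=.
by rewrite rmorph0 subr0 (socle_maxideal nR hR).
Qed.

Definition connected_sum : localRing k :=
  quot_local (@ideal_gen_ideal P _ : is_ideal csum_ideal) csum_ideal_max.

Definition nontrivial_connected_sum : Prop :=
  ~ ring_isom connected_sum R /\ ~ ring_isom connected_sum S.

End ConnectedSum.

(* gr(T) is built as the quotient of the Rees algebra (+)_i m^i X^i, a subring
   of T[X], by its ideal (+)_i m^(i+1) X^i; its component of degree i is thus
   m^i / m^(i+1). *)

Section Rees.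
Variables (k : fieldType) (T : localRing k).

Local Notation mpow := (ideal_pow (maxideal T)).

Definition rees_pred : {pred {poly T}} := fun p => `[< forall i, mpow i p`_i >].

Lemma rees_subring : subring_closed rees_pred.
Proof.
split=> [|p q|p q]; rewrite !unfold_in.
- apply/asboolP => i; rewrite coef1.
  by case: i => //= i; case: (ideal_pow_ideal (maxideal T) i.+1).
- move=> /asboolP hp /asboolP hq; apply/asboolP => i; rewrite coefB.
  by apply: idealB; [apply: ideal_pow_ideal|apply: hp|apply: hq].
- move=> /asboolP hp /asboolP hq; apply/asboolP => i; rewrite coefM.
  apply: ideal_sum => [|j _]; first exact: ideal_pow_ideal.
  by rewrite -{1}(subnKC (leq_ord j)); apply: ideal_powM.
Qed.

HB.instance Definition _ :=
  GRing.isSubringClosed.Build {poly T} rees_pred rees_subring.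

Record rees := Rees { rees_val : {poly T}; _ : rees_val \in rees_pred }.

HB.instance Definition _ := [isSub for rees_val].
HB.instance Definition _ := [Choice of rees by <:].
HB.instance Definition _ := [SubChoice_isSubComNzRing of rees by <:].

Lemma reesP (p : rees) i : mpow i (rees_val p)`_i.
Proof. by case: p => p /= /asboolP. Qed.

Definition gr_pred : {pred rees} :=
  fun p => `[< forall i, mpow i.+1 (rees_val p)`_i >].

Lemma gr_idealr : idealr_closed gr_pred.
Proof.
split; rewrite ?unfold_in.
- apply/asboolP => i; rewrite coef0.
  by case: (ideal_pow_ideal (maxideal T) i.+1).
- apply/negP => /asboolP /(_ 0%N); rewrite coef1 => /ideal_pow1.
  by move=> /(_ (ker_ideal _)); rewrite /maxideal /= rmorph1; apply/eqP/oner_neq0.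
- move=> a p q /asboolP hp /asboolP hq; apply/asboolP => i; rewrite coefD.
  have idm := ideal_pow_ideal (maxideal T) i.+1.
  case: (idm) => _ D _; apply: D => //; rewrite coefM.
  apply: ideal_sum => // j _.
  by rewrite -{1}(subnKC (leq_ord j)) -addnS; apply: ideal_powM => //; apply: reesP.
Qed.

HB.instance Definition _ := isIdealr.Build rees gr_pred gr_idealr.

Local Notation G := {ideal_quot gr_pred}.

Definition gr_gcomp (i : nat) : set G :=
  [set x | exists p : rees,
    (forall j, j != i -> (rees_val p)`_j = 0) /\ x = \pi_G p].

Definition gr_aug (x : G) : k := res T (rees_val (repr x))`_0.

Lemma gr_eqP (p q : rees) :
  \pi_G p = \pi_G q <-> forall i, mpow i.+1 ((rees_val p)`_i - (rees_val q)`_i).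
Proof.
split=> [/eqP|pq].
  rewrite -Quotient.idealrBE unfold_in => /asboolP h i.
  by have := h i; rewrite coefB.
apply/eqP; rewrite -Quotient.idealrBE unfold_in; apply/asboolP => i.
by rewrite coefB.
Qed.

Lemma gr_augE (p : rees) : gr_aug (\pi_G p) = res T (rees_val p)`_0.
Proof.
apply/eqP; rewrite /gr_aug -subr_eq0 -rmorphB; apply/eqP.
have /gr_eqP /(_ 0%N) : \pi_G (repr (\pi_G p)) = \pi_G p by rewrite reprK.
by move/ideal_pow1; apply; apply: ker_ideal.
Qed.

Lemma gr_aug_zmod : zmod_morphism gr_aug.
Proof.
by move=> x y; rewrite -[x]reprK -[y]reprK -rmorphB !gr_augE coefB rmorphB.
Qed.

Lemma gr_aug_monoid : monoid_morphism gr_aug.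
Proof.
split=> [|x y]; first by rewrite -(rmorph1 \pi_G) gr_augE coef1 rmorph1.
by rewrite -[x]reprK -[y]reprK -rmorphM !gr_augE coef0M rmorphM.
Qed.

HB.instance Definition _ := GRing.isZmodMorphism.Build G k gr_aug gr_aug_zmod.
HB.instance Definition _ :=
  GRing.isMonoidMorphism.Build G k gr_aug gr_aug_monoid.

Lemma monomial_rees i (a : T) : mpow i a -> a *: 'X^i \in rees_pred.
Proof.
move=> ia; rewrite unfold_in; apply/asboolP => j; rewrite coefZ coefXn.
have [->|_] := eqVneq j i; first by rewrite mulr1.
by rewrite mulr0; case: (ideal_pow_ideal (maxideal T) j).
Qed.

Definition monomial i (a : T) (ia : mpow i a) : rees := Rees (monomial_rees ia).

Lemma coef_monomial i a (ia : mpow i a) j :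
  (rees_val (monomial ia))`_j = if j == i then a else 0.
Proof. by rewrite /= coefZ coefXn; case: eqP; rewrite ?mulr1 ?mulr0. Qed.

Lemma gr_gcomp0 i : gr_gcomp i 0.
Proof. by exists 0; split=> [j _|]; rewrite ?coef0 ?rmorph0. Qed.

Lemma gr_gcompB i x y : gr_gcomp i x -> gr_gcomp i y -> gr_gcomp i (x - y).
Proof.
move=> [p [hp ->]] [q [hq ->]]; exists (p - q); split=> [j ji|].
  by rewrite coefB hp ?hq ?subr0.
by rewrite rmorphB.
Qed.

Lemma gr_gcomp1 : gr_gcomp 0%N 1.
Proof.
exists 1; split=> [j j0|]; last by rewrite rmorph1.
by rewrite coef1 (negbTE j0).
Qed.

Lemma gr_gcompM i j x y :
  gr_gcomp i x -> gr_gcomp j y -> gr_gcomp (i + j)%N (x * y).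
Proof.
move=> [p [hp ->]] [q [hq ->]]; exists (p * q); split; last by rewrite rmorphM.
move=> l lij; rewrite coefM big1 // => -[a /= al] _.
have [ai|ai] := eqVneq a i; last by rewrite hp ?mul0r.
rewrite hq ?mulr0 //; apply: contraNN lij => /eqP <-.
by rewrite -ai subnKC // -ltnS.
Qed.

Lemma rees_val_sum n (h : nat -> rees) :
  rees_val (\sum_(i < n) h i) = \sum_(i < n) rees_val (h i).
Proof.
elim: n => [|n IH]; first by rewrite !big_ord0.
by rewrite !big_ord_recr /= -[LHS]/(rees_val _ + rees_val _) IH.
Qed.

Lemma gr_gcomp_span (x : G) : exists n (h : nat -> G),
  (forall i, gr_gcomp i (h i)) /\ x = \sum_(i < n) h i.
Proof.
set p := repr x; exists (size (rees_val p)).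
exists (fun i => \pi_G (monomial (reesP p i))); split=> [i|].
  exists (monomial (reesP p i)); split=> // j ji.
  by rewrite coef_monomial (negbTE ji).
rewrite -(rmorph_sum \pi_G) -[LHS]reprK; congr (\pi_G _); apply: val_inj => /=.
rewrite (rees_val_sum _ (fun i => monomial (reesP p i))) /=.
by rewrite -/p -{1}[rees_val p]coefK poly_def.
Qed.

Lemma gr_gcomp_free n (h : nat -> G) :
    (forall i, gr_gcomp i (h i)) -> \sum_(i < n) h i = 0 ->
  forall i, (i < n)%N -> h i = 0.
Proof.
move=> /choice[p pP]; rewrite (eq_bigr (fun i : 'I_n => \pi_G (p i))); last first.
  by move=> i _; apply: (pP i).2.
have pi0 : (0 : G) = \pi_G 0 by rewrite rmorph0.
rewrite -(rmorph_sum \pi_G) pi0 => /gr_eqP h0 i ltin.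
apply: (etrans (pP i).2); apply/gr_eqP => j.
rewrite coef0 subr0; have [->|ji] := eqVneq j i; last first.
  by rewrite (pP i).1 //; case: (ideal_pow_ideal (maxideal T) j.+1).
have := h0 i; rewrite rees_val_sum coef0 subr0 coef_sum.
rewrite (bigD1 (Ordinal ltin)) //= big1 ?addr0 // => l li.
by rewrite (pP l).1 // eq_sym.
Qed.

Lemma gr_aug_bij0 c : exists! x, gr_gcomp 0%N x /\ gr_aug x = c.
Proof.
have [a ac] := res_surj T c; have a0 : mpow 0 a by [].
exists (\pi_G (monomial a0)); split.
  split; last by rewrite gr_augE coef_monomial eqxx.
  by exists (monomial a0); split=> // j j0; rewrite coef_monomial (negbTE j0).
move=> _ [[p [hp ->]]]; rewrite gr_augE => pc; apply/gr_eqP => j.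
rewrite coef_monomial; have [->|j0] := eqVneq j 0%N; last first.
  by rewrite hp // subr0; case: (ideal_pow_ideal (maxideal T) j.+1).
apply: sub_ideal_gen; exists 1, (a - (rees_val p)`_0); split; rewrite ?mul1r //.
by rewrite /maxideal /= rmorphB ac pc subrr.
Qed.

Lemma gr_aug_gt0 i x : (0 < i)%N -> gr_gcomp i x -> gr_aug x = 0.
Proof.
by move=> i0 [p [hp ->]]; rewrite gr_augE hp ?rmorph0 // neq_ltn i0.
Qed.

Definition assoc_graded : gradedAlgebra k :=
  @GradedAlgebra k G gr_aug gr_gcomp gr_gcomp0 gr_gcompB gr_gcomp1 gr_gcompM
    gr_gcomp_span gr_gcomp_free gr_aug_bij0 gr_aug_gt0.

End Rees.

(* Main.v *)
(** Write r = ll(R) > s = ll(S), P = R x_k S and Q = P / I, where I is the line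
spanned by (dR, - dS).  The generator dR lies in m_R^r, hence deeper than any
power of m_S that survives, so passing to the quotient by I only kills dS in
degree s of gr(P): both gr(Q) and gr(R) x_k gr(S / soc S) are quotients of the
Rees algebra of P, with the same kernel.

If Q were isomorphic to a standard graded algebra, take b in m_S^(s-1) outside
m_S^s.  The image x of (0, b) satisfies x m_Q <= soc Q = m_Q^r with r > s, so
the initial form of x, of degree s - 1, is killed by G_1, hence is in the
socle; but the socle sits in degree r, so x lies in m_Q^s, which contradicts
the choice of b.  In particular Q is not isomorphic to the standard graded
rings R and S. *)

Require Import Defs.
From HB Require Import structures.
From mathcomp Require Import all_boot all_order all_algebra ring_quotient.
From mathcomp Require Import boolp classical_sets.

Set Implicit Arguments.
Unset Strict Implicit.
Unset Printing Implicit Defensive.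

Import GRing.Theory.
Local Open Scope ring_scope.
Local Open Scope classical_set_scope.
Local Open Scope quotient_scope.


(** * Generated ideals and powers of an ideal *)

Section IdealTheory.
Variable T : comNzRingType.
Implicit Types (I J A : set T).

Lemma ideal_gen1P (d x : T) : ideal_gen [set d] x <-> exists t, x = t * d.
Proof.
split=> [|[t ->] I [_ _ M] dI]; last by apply: M; apply: dI.
move=> /(_ [set x | exists t, x = t * d]); apply=> [|_ ->]; last first.
  by exists 1; rewrite mul1r.
split=> [|_ _ [t ->] [u ->]|a _ [t ->]]; first by exists 0; rewrite mul0r.
- by exists (t + u); rewrite mulrDl.
- by exists (a * t); rewrite mulrA.
Qed.

Lemma ideal_gen_sum A x : ideal_gen A x ->
  exists s : seq (T * T),
    (forall u, u \in s -> A u.2) /\ x = \sum_(u <- s) u.1 * u.2.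
Proof.
move=> /(_ [set x | exists s : seq (T * T),
  (forall u, u \in s -> A u.2) /\ x = \sum_(u <- s) u.1 * u.2]).
apply=> [|y Ay]; last first.
  exists [:: (1, y)]; split=> [u|]; first by rewrite inE => /eqP ->.
  by rewrite big_seq1 mul1r.
split=> [|_ _ [s [sA ->]] [t [tA ->]]|a _ [s [sA ->]]].
- by exists [::]; rewrite big_nil.
- exists (s ++ t); rewrite big_cat; split=> // u.
  by rewrite mem_cat => /orP[/sA|/tA].
- exists [seq (a * u.1, u.2) | u <- s]; split=> [_ /mapP[u us ->]|]; first exact: (sA u us).
  by rewrite big_map mulr_sumr; apply: eq_bigr => u _; rewrite mulrA.
Qed.

Lemma ideal_pow_le I i j : (i <= j)%N -> ideal_pow I j `<=` ideal_pow I i.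
Proof.
move=> /subnK <-; elim: (j - i)%N => [|n IH] x //.
by rewrite addSn => /ideal_powS /IH.
Qed.

Lemma ideal_pow_stable I i n :
  ideal_pow I i `<=` ideal_pow I i.+1 ->
  ideal_pow I (n + i) `<=` ideal_pow I (n + i).+1.
Proof.
move=> h; elim: n => // n IH x; rewrite addSn.
apply; first exact: (ideal_pow_ideal I (n + i).+2).
move=> _ [a [b [/IH Ia Ib ->]]]; apply: sub_ideal_gen.
by exists a, b.
Qed.

Lemma ideal_pow_eq0 I n : ideal_pow I n `<=` [set 0] -> ideal_pow I n = [set 0].
Proof.
move=> h; apply/seteqP; split=> // _ ->.
by case: (ideal_pow_ideal I n).
Qed.

End IdealTheory.

(** * Nilpotence, Loewy length and socle of an Artinian local ring *)

Section LocalRingTheory.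
Variables (k : fieldType) (T : localRing k).
Local Notation m := (maxideal T).

Lemma maxideal_ideal : is_ideal m.
Proof. exact: ker_ideal. Qed.

Lemma maxideal_pow1 : ideal_pow m 1 = m.
Proof.
apply/seteqP; split=> x; first by apply: ideal_pow1 maxideal_ideal _.
by move=> mx; apply: sub_ideal_gen; exists 1, x; rewrite mul1r.
Qed.

Lemma res_neq0_cancel (x y : T) : res T x <> 0 -> x * y = 0 -> y = 0.
Proof.
move=> /eqP /res_unit[z zx] xy; by rewrite -[y]mul1r -zx -mulrA xy mulr0.
Qed.

(** Let J = m^N be the stable power and suppose that it has a nonzero element. Call [x] bad when x J
    is nonzero. As J = m J, a bad [x] has a bad multiple by an element of m; iterating from 1 gives
    a descending chain of principal ideals, whose stability forces a bad element to be 0. *)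
Lemma artinian_nilpotent : artinian T -> exists N, ideal_pow m N `<=` [set 0].
Proof.
move=> artT.
have [N stabN] := artT _ (ideal_pow_ideal m) (@ideal_powS T m).
exists N => z mz; apply: contrapT => /= z0.
set J := ideal_pow m N in mz.
pose bad x := exists a, J a /\ x * a <> 0.
have step x : exists b, bad x -> m b /\ bad (x * b).
  have [[a [Ja xa]]|] := pselect (bad x); last by exists 0.
  apply: contrapT => /forallNP nob; apply: xa.
  have : ideal_pow m N.+1 a by rewrite stabN.
  move=> /(_ [set a | x * a = 0]); apply.
    split=> [|u v /= xu xv|c u /= xu]; first by rewrite /= mulr0.
      by rewrite mulrDr xu xv addr0.
    by rewrite mulrCA xu mulr0.
  move=> _ [u [v [Ju mv ->]]] /=; apply: contrapT => xuv.
  apply: (nob v) => _; split=> //; exists u; split=> //.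
  by rewrite -mulrA (mulrC v).
have [F FP] := choice step.
pose X n := iter n (fun x => x * F x) 1.
have badX n : bad (X n).
  elim: n => [|n /FP[]//]; by exists z; rewrite mul1r.
have [||n stabn] := artT (fun n => ideal_gen [set X n]).
- by move=> n; apply: ideal_gen_ideal.
- move=> n x /ideal_gen1P[t ->]; apply/ideal_gen1P; exists (t * F (X n)).
  by rewrite mulrAC -mulrA.
have : ideal_gen [set X n.+1] (X n).
  by rewrite (stabn n.+1 (leqnSn n)); apply: sub_ideal_gen.
move=> /ideal_gen1P[t Xn]; have [mF [a [Ja]]] := FP _ (badX n).
(* Stability makes 1 - t F (X n) kill X n; this factor has residue 1, hence is invertible. *)
have [a0 [_]] := badX n; rewrite (@res_neq0_cancel (1 - t * F (X n)) (X n)) ?mul0r //.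
  rewrite rmorphB rmorph1 rmorphM (mF : res T _ = 0) mulr0 subr0.
  by apply/eqP/oner_neq0.
by rewrite mulrBl mul1r {1}Xn -[X n.+1]/(X n * F (X n)) [X n * F _]mulrC mulrA subrr.
Qed.

(** The least n with m^n = 0 is positive because 1 is nonzero, and its predecessor is the maximum
    sought; hence [xget] does not return its default. *)
Lemma loewy_lengthP : artinian T ->
  ideal_pow m (loewy_length T) <> [set 0] /\
  ideal_pow m (loewy_length T).+1 = [set 0].
Proof.
move=> /artinian_nilpotent[N nilN].
have exN : exists n, `[< ideal_pow m n = [set 0] >].
  by exists N; apply/asboolP/ideal_pow_eq0.
case: (ex_minnP exN) => -[|n] /asboolP mn minn.
  have : ideal_pow m 0 1 by [].
  by rewrite mn => /eqP; rewrite (negbTE (oner_neq0 _)).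
pose L := [set n | ideal_pow m n <> [set 0] /\
  forall j, ideal_pow m j <> [set 0] -> (j <= n)%N].
have Ln : L n.
  split=> [h|j h]; first by have /minn := asboolT h; rewrite ltnn.
  rewrite leqNgt; apply/negP => ltnj; apply: h; apply: ideal_pow_eq0.
  by rewrite -mn; apply: ideal_pow_le.
have [L1 L2] : L (loewy_length T) by apply: (@xgetPex _ 0%N L); exists n.
split=> //; apply: contrapT => /L2; by rewrite ltnn.
Qed.

Section Socle.
Variable d : T.
Hypotheses (socd : socle T = ideal_gen [set d]) (d0 : d <> 0).

Lemma socleP x : socle T x <-> exists t, x = t * d.
Proof. by rewrite socd; apply: ideal_gen1P. Qed.

Lemma socle_gen_max x : m x -> x * d = 0.
Proof.
move=> mx; rewrite mulrC; have : socle T d by rewrite socd; apply: sub_ideal_gen.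
exact.
Qed.

Lemma mul_socle_gen_eq0 t : t * d = 0 -> m t.
Proof. by move=> td; apply: contrapT => /res_neq0_cancel /(_ td). Qed.

Hypothesis artT : artinian T.

Lemma loewy_top x : ideal_pow m (loewy_length T).+1 x -> x = 0.
Proof. by have [_ ->] := loewy_lengthP artT. Qed.

Lemma loewy_socle x : ideal_pow m (loewy_length T) x -> socle T x.
Proof.
move=> mx y my; apply: loewy_top; rewrite -addn1; apply: ideal_powM => //.
by rewrite maxideal_pow1.
Qed.

(** A nonzero element of the last nonzero power is in the socle, so it is t d, and t is a unit
    because m kills [d]. *)
Lemma socle_gen_loewy : ideal_pow m (loewy_length T) d.
Proof.
have [nz _] := loewy_lengthP artT.
have [x [mx x0]] : exists x, ideal_pow m (loewy_length T) x /\ x <> 0.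
  apply: contrapT => /forallNP h; apply/nz/ideal_pow_eq0 => x mx.
  by apply: contrapT => x0; apply: (h x).
have /socleP[t xt] := loewy_socle mx.
have /eqP/res_unit[u ut] : res T t <> 0.
  by move=> /socle_gen_max td; apply: x0; rewrite xt.
rewrite -[d]mul1r -ut -mulrA -xt.
by case: (ideal_pow_ideal m (loewy_length T)) => _ _; apply.
Qed.

(** If m^i were contained in m^(i+1), this would persist up to the last nonzero power, which
    contains [d], and make it zero. *)
Lemma loewy_pow_strict i : (i <= loewy_length T)%N ->
  exists x, ideal_pow m i x /\ ~ ideal_pow m i.+1 x.
Proof.
move=> il; apply: contrapT => /forallNP h; apply: d0; apply: loewy_top.
rewrite -(subnK il); apply: ideal_pow_stable; last by rewrite subnK //; apply: socle_gen_loewy.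
by move=> x mx; apply: contrapT => nx; apply: (h x).
Qed.

End Socle.

Lemma socle_gen_neq0 d : gorenstein T -> socle T = ideal_gen [set d] -> d <> 0.
Proof.
move=> [c [c0 socc]] socd d0; apply: c0.
have : socle T c by rewrite socc; apply: sub_ideal_gen.
by move=> /(socleP socd)[t ->]; rewrite d0 mulr0.
Qed.

End LocalRingTheory.

(** * Morphisms compatible with the residue maps, and quotients *)

Section LocalMorphism.
Variables (k : fieldType) (T T' : localRing k) (f : {rmorphism T -> T'}).
Hypothesis fres : forall x, res T' (f x) = res T x.

Lemma rmorph_maxideal_pow i x :
  ideal_pow (maxideal T) i x -> ideal_pow (maxideal T') i (f x).
Proof.
elim: i x => [|i IH] x //.
have [I0 ID IM] := ideal_pow_ideal (maxideal T') i.+1.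
move=> /(_ [set x | ideal_pow (maxideal T') i.+1 (f x)]); apply.
  split=> [|u v|a u] /=; first by rewrite rmorph0.
    by rewrite rmorphD; apply: ID.
  by rewrite rmorphM; apply: IM.
move=> _ [a [b [Ia Ib ->]]] /=; rewrite rmorphM; apply: sub_ideal_gen.
by exists (f a), (f b); split; [apply: IH|rewrite /maxideal /= fres|].
Qed.

Hypothesis fsurj : forall y, exists x, f x = y.

Lemma surj_maxideal_pow i y : ideal_pow (maxideal T') i y ->
  exists x, ideal_pow (maxideal T) i x /\ f x = y.
Proof.
elim: i y => [|i IH] y; first by move=> _; have [x] := fsurj y; exists x.
have [I0 ID IM] := ideal_pow_ideal (maxideal T) i.+1.
move=> /(_ [set y | exists x, ideal_pow (maxideal T) i.+1 x /\ f x = y]); apply.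
  split=> [|_ _ [u [Iu <-]] [v [Iv <-]]|a _ [u [Iu <-]]].
  - by exists 0; rewrite rmorph0.
  - by exists (u + v); rewrite rmorphD; split=> //; apply: ID.
  - have [c <-] := fsurj a; exists (c * u); rewrite rmorphM.
    by split=> //; apply: IM.
move=> _ [a [b [/IH[u [Iu <-]] mb ->]]]; have [v fv] := fsurj b.
exists (u * v); rewrite rmorphM fv; split=> //; apply: sub_ideal_gen.
by exists u, v; split; rewrite // /maxideal /= -fres fv.
Qed.

End LocalMorphism.

Lemma quot_localP (k : fieldType) (T : localRing k) (I : set T) (idI : is_ideal I)
    (Im : I `<=` maxideal T) :
  exists f : {rmorphism T -> quot_local idI Im},
    [/\ forall x, res (quot_local idI Im) (f x) = res T x,
        forall y, exists x, f x = y & forall x, f x = 0 <-> I x].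
Proof.
exists (\pi_({ideal_quot (quot_pred idI Im)}) : {rmorphism _ -> _}); split.
- exact: quot_resE.
- by move=> y; exists (repr (y : {ideal_quot (quot_pred idI Im)})); apply: reprK.
move=> x; rewrite -(rmorph0 \pi_({ideal_quot (quot_pred idI Im)})).
split=> [/eqP|Ix]; last apply/eqP; rewrite -Quotient.idealrBE unfold_in subr0.
  by move/asboolP.
exact/asboolP.
Qed.

Local Notation gr T := {ideal_quot (@gr_pred _ T)}.

(** The isomorphism is [g] after a set-theoretic section of [f]; equality of kernels makes it a
    morphism. It will compare two quotients of one Rees algebra. *)
Lemma surj_same_kernel (X Y Z : pzRingType)
    (f : {rmorphism X -> Y}) (g : {rmorphism X -> Z}) :
    (forall y, exists x, f x = y) -> (forall z, exists x, g x = z) ->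
    (forall x, f x = 0 <-> g x = 0) ->
  exists h : {rmorphism Y -> Z}, bijective h /\ forall x, h (f x) = g x.
Proof.
move=> fsurj gsurj ker.
have [s sK] := choice fsurj; have [t tK] := choice gsurj.
have eqfg x x' : f x = f x' <-> g x = g x'.
  split=> /eqP; rewrite -subr_eq0 -rmorphB => /eqP /ker /eqP;
    by rewrite rmorphB subr_eq0 => /eqP.
pose h y := g (s y).
have hf x : h (f x) = g x by apply/eqfg; rewrite sK.
have hB : zmod_morphism h.
  by move=> y y'; rewrite -[y]sK -[y']sK -rmorphB !hf rmorphB.
have hM : monoid_morphism h.
  split=> [|y y']; first by rewrite -(rmorph1 f) hf rmorph1.
  by rewrite -[y]sK -[y']sK -rmorphM !hf rmorphM.
pose H : {rmorphism Y -> Z} := HB.pack h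
  (GRing.isZmodMorphism.Build Y Z h hB) (GRing.isMonoidMorphism.Build Y Z h hM).
exists H; split=> //; exists (fun z => f (t z)) => [y|z] /=; last by rewrite hf.
by rewrite -[y]sK hf; apply/eqfg; rewrite tK.
Qed.

(** The class of [x] in degree 1 is nonzero, so it would be invertible in a field; but the ring
    morphism [aug] kills it. *)
Lemma assoc_graded_not_field (k : fieldType) (T : localRing k) (x : T) :
  maxideal T x -> ~ ideal_pow (maxideal T) 2 x ->
  ~ ring_isom (assoc_graded T) k.
Proof.
move=> mx m2x [f [g fK gK]].
have m1x : ideal_pow (maxideal T) 1 x by rewrite maxideal_pow1.
pose X : assoc_graded T := \pi_(gr T) (monomial m1x).
have X0 : X != 0.
  apply: contra_notN m2x => /eqP; rewrite -(rmorph0 \pi_(gr T)).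
  by move/gr_eqP/(_ 1%N); rewrite coef_monomial eqxx coef0 subr0.
have fX0 : f X != 0.
  by apply: contraNneq X0 => fX; rewrite -[X]fK fX -(rmorph0 f) fK.
have : X * g (f X)^-1 = 1.
  by rewrite -[LHS]fK rmorphM gK divff // -(rmorph1 f) fK.
move/(congr1 (aug _)); rewrite rmorphM rmorph1 /= gr_augE coef_monomial /=.
by rewrite rmorph0 mul0r => /eqP; rewrite eq_sym (negbTE (oner_neq0 _)).
Qed.

(** * Associated graded rings as quotients of a Rees algebra *)

Section ReesMap.
Variables (k : fieldType) (T T' : localRing k) (f : {rmorphism T -> T'}).
Hypothesis fres : forall x, res T' (f x) = res T x.

Lemma map_rees_subproof (p : rees T) : map_poly f (rees_val p) \in @rees_pred k T'.
Proof.
rewrite unfold_in; apply/asboolP => i; rewrite coef_map.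
exact/(rmorph_maxideal_pow fres)/reesP.
Qed.

Definition rees_to_gr (p : rees T) : (gr T') :=
  \pi_(gr T') (Rees (map_rees_subproof p)).

Lemma rees_to_gr_zmod : zmod_morphism rees_to_gr.
Proof.
move=> p q; rewrite /rees_to_gr -rmorphB; congr (\pi_(gr T') _); apply: val_inj => /=.
by rewrite rmorphB.
Qed.

Lemma rees_to_gr_monoid : monoid_morphism rees_to_gr.
Proof.
split=> [|p q].
  by rewrite /rees_to_gr -(rmorph1 \pi_(gr T')); congr (\pi_(gr T') _); apply: val_inj; rewrite /= rmorph1.
rewrite /rees_to_gr -rmorphM; congr (\pi_(gr T') _); apply: val_inj => /=.
by rewrite rmorphM.
Qed.

HB.instance Definition _ := GRing.isZmodMorphism.Build
  (rees T) (gr T') rees_to_gr rees_to_gr_zmod.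
HB.instance Definition _ := GRing.isMonoidMorphism.Build
  (rees T) (gr T') rees_to_gr rees_to_gr_monoid.

Lemma rees_to_gr_eq0 p : rees_to_gr p = 0 <->
  forall i, ideal_pow (maxideal T') i.+1 (f (rees_val p)`_i).
Proof.
rewrite -(rmorph0 \pi_(gr T')) gr_eqP; split=> h i; have := h i;
  by rewrite /= coef0 subr0 coef_map.
Qed.

Lemma rees_to_gr_gcomp i p : gr_gcomp i (rees_to_gr p) <->
  forall j, j != i -> ideal_pow (maxideal T') j.+1 (f (rees_val p)`_j).
Proof.
split=> [[q [q0 /gr_eqP pq]] j ji|h].
  by have := pq j; rewrite q0 // subr0 /= coef_map.
pose q := rees_val (Rees (map_rees_subproof p)).
have mq : ideal_pow (maxideal T') i q`_i by apply: reesP.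
exists (monomial mq); split=> [j ji|]; first by rewrite coef_monomial (negbTE ji).
apply/gr_eqP => j; rewrite coef_monomial; have [->|ji] := eqVneq j i.
  by rewrite subrr; case: (ideal_pow_ideal (maxideal T') i.+1).
by rewrite subr0 /= coef_map; apply: h.
Qed.

Lemma rees_to_gr_aug p : gr_aug (rees_to_gr p) = res T (rees_val p)`_0.
Proof. by rewrite gr_augE /= coef_map /= fres. Qed.

End ReesMap.

Section GrFibreProduct.
Variables (k : fieldType) (P Q R S : localRing k).
Variables (q : {rmorphism P -> Q}) (f : {rmorphism P -> R}) (g : {rmorphism P -> S}).
Hypotheses (qres : forall x, res Q (q x) = res P x)
           (fres : forall x, res R (f x) = res P x)
           (gres : forall x, res S (g x) = res P x).

Lemma rees_to_fibprod_subproof p :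
  aug (assoc_graded R) (rees_to_gr fres p) = aug (assoc_graded S) (rees_to_gr gres p).
Proof. by rewrite /= !rees_to_gr_aug. Qed.

Definition rees_to_fibprod (p : rees P) :=
  mk_fibprod (rees_to_fibprod_subproof p).

Local Notation F := (fibprod (aug (assoc_graded R)) (aug (assoc_graded S))).

Lemma rees_to_fibprod_zmod : zmod_morphism rees_to_fibprod.
Proof. by move=> x y; apply: val_inj; rewrite /= !rmorphB. Qed.

Lemma rees_to_fibprod_monoid : monoid_morphism rees_to_fibprod.
Proof.
split=> [|x y]; apply: val_inj; first by rewrite /= !rmorph1.
by rewrite /= !rmorphM.
Qed.

HB.instance Definition _ := GRing.isZmodMorphism.Build
  (rees P) F rees_to_fibprod rees_to_fibprod_zmod.
HB.instance Definition _ := GRing.isMonoidMorphism.Build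
  (rees P) F rees_to_fibprod rees_to_fibprod_monoid.

Hypothesis qsurj : forall y, exists x, q x = y.
Hypothesis fg_lift : forall i a b,
  ideal_pow (maxideal R) i a -> ideal_pow (maxideal S) i b -> res R a = res S b ->
  exists z, [/\ ideal_pow (maxideal P) i z, f z = a & g z = b].
Hypothesis ker_fg : forall i z, ideal_pow (maxideal P) i z ->
  ideal_pow (maxideal Q) i.+1 (q z) <->
  ideal_pow (maxideal R) i.+1 (f z) /\ ideal_pow (maxideal S) i.+1 (g z).

(** Lifts chosen degree by degree need not vanish where the lifted coefficient does, hence the
    truncation. *)
Lemma rees_of_coefs (z : nat -> P) n : (forall i, ideal_pow (maxideal P) i (z i)) ->
  exists p : rees P, forall i, (rees_val p)`_i = if (i < n)%N then z i else 0.
Proof.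
move=> mz; have pP : \poly_(i < n) z i \in @rees_pred k P.
  rewrite unfold_in; apply/asboolP => i; rewrite coef_poly.
  by case: ifP => _ //; case: (ideal_pow_ideal (maxideal P) i).
by exists (Rees pP) => i; rewrite /= coef_poly.
Qed.

Lemma rees_to_gr_surj y : exists p, rees_to_gr qres p = y.
Proof.
have [z zP] := choice (fun i => surj_maxideal_pow qres qsurj (reesP (repr y) i)).
have [p pz] := rees_of_coefs (size (rees_val (repr y))) (fun i => (zP i).1).
exists p; rewrite -[y]reprK; congr (\pi_(gr Q) _); apply: val_inj; apply/polyP => i /=.
rewrite coef_map pz; case: ltnP => [_|le]; first exact: (zP i).2.
by rewrite /= rmorph0 nth_default.
Qed.

Lemma rees_to_fibprod_surj y : exists p, rees_to_fibprod p = y.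
Proof.
have e := fibprodP y.
pose a := repr (fibprod_val y).1; pose b := repr (fibprod_val y).2.
have lift i : exists z, [/\ ideal_pow (maxideal P) i z,
    f z = (rees_val a)`_i & g z = (rees_val b)`_i].
  (* In degree 0 the residues agree because [y] lies in the fibre product; in positive degree both
     are 0. *)
  case: i => [|i]; apply: fg_lift; try exact: reesP.
    by have := e; rewrite -[(fibprod_val y).1]reprK -[(fibprod_val y).2]reprK /= !gr_augE.
  have mT (T : localRing k) x : ideal_pow (maxideal T) i.+1 x -> res T x = 0.
    by move=> /(ideal_pow_le (ltn0Sn i)); rewrite maxideal_pow1.
  by rewrite !mT //; apply: reesP.
have [z zP] := choice lift.
have [|p pz] := @rees_of_coefs z (maxn (size (rees_val a)) (size (rees_val b))).
  by move=> i; case: (zP i).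
exists p; apply: val_inj => /=.
rewrite [RHS]surjective_pairing -[(fibprod_val y).1]reprK -[(fibprod_val y).2]reprK.
congr (\pi_(gr R) _, \pi_(gr S) _); apply: val_inj; apply/polyP => i; rewrite /= coef_map pz;
  have [_ fz gz] := zP i; case: ltnP; rewrite ?fz ?gz // geq_max => /andP[? ?];
  by rewrite /= rmorph0 nth_default.
Qed.

(** By [ker_fg], applied to each coefficient, the two surjections from the Rees algebra have the
    same kernel. Degrees and augmentations are preserved because both are read off from the
    coefficients of a preimage. *)
Lemma assoc_graded_fibprod :
  graded_isom (assoc_graded Q) (fibprod_graded (assoc_graded R) (assoc_graded S)).
Proof.
have [||x|h [bijh hE]] := @surj_same_kernel (rees P) _ _
  (rees_to_gr qres : {rmorphism _ -> _}) (rees_to_fibprod : {rmorphism _ -> _}).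
- exact: rees_to_gr_surj.
- exact: rees_to_fibprod_surj.
- split=> [/rees_to_gr_eq0 h|].
    apply: val_inj; congr (_, _); apply/rees_to_gr_eq0 => i;
    by have [] := (ker_fg (reesP x i)).1 (h i).
  move=> /(congr1 val)[] /rees_to_gr_eq0 hf /rees_to_gr_eq0 hg.
  by apply/rees_to_gr_eq0 => i; apply/(ker_fg (reesP x i)); split.
exists h; split=> // [i x|x]; have [p <-] := rees_to_gr_surj x; rewrite hE.
  split=> [/rees_to_gr_gcomp hp|[/rees_to_gr_gcomp hf /rees_to_gr_gcomp hg]].
    split; apply/rees_to_gr_gcomp => j /hp; by case/(ker_fg (reesP p j)).
  apply/rees_to_gr_gcomp => j ji; apply/(ker_fg (reesP p j)).
  by split; [apply: hf|apply: hg].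
by rewrite /= /fibprod_res /= !rees_to_gr_aug.
Qed.

End GrFibreProduct.

(** * Homogeneous decomposition in a graded algebra *)

Section GradedDecomposition.
Variables (k : fieldType) (G : gradedAlgebra k).

Lemma gcompD i (x y : G) : gcomp i x -> gcomp i y -> gcomp i (x + y).
Proof.
move=> xi yi; rewrite -[y]opprK; apply: gcompB => //.
by rewrite -sub0r; apply: gcompB => //; apply: gcomp0.
Qed.

Definition homogeneous_coefs (p : {poly G}) := forall i, gcomp i p`_i.

(** Evaluation at 1 sums the coefficients, so this is [gcomp_free] applied to p - q. *)
Lemma homogeneous_coefs_inj (p q : {poly G}) :
  homogeneous_coefs p -> homogeneous_coefs q -> p.[1] = q.[1] -> p = q.
Proof.
move=> hp hq /eqP; rewrite -subr_eq0 -hornerN -hornerD => /eqP pq.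
apply/eqP; rewrite -subr_eq0; apply/eqP/polyP => i; rewrite coef0.
have [lt|] := ltnP i (size (p - q)); last exact: nth_default.
apply: (@gcomp_free k G _ (fun i => (p - q)`_i) _ _ i lt) => [j|].
  by rewrite coefB; apply: gcompB.
by rewrite -[RHS]pq horner_coef; apply: eq_bigr => j _; rewrite expr1n mulr1.
Qed.

Lemma homogeneous_coefs_ex (x : G) :
  exists p : {poly G}, homogeneous_coefs p /\ p.[1] = x.
Proof.
have [n [f [hf ->]]] := gcomp_span x; exists (\poly_(i < n) f i); split=> [i|].
  by rewrite coef_poly; case: ifP => // _; apply: gcomp0.
by rewrite horner_poly; apply: eq_bigr => i _; rewrite expr1n mulr1.
Qed.

(* The decomposition x = sum_i x_i is recorded as the polynomial sum_i x_i X^i;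
   in this form it is a ring morphism with left inverse the evaluation at 1. *)
Definition decomposition (x : G) : {poly G} := projT1 (cid (homogeneous_coefs_ex x)).

Lemma decomposition_gcomp x i : gcomp i (decomposition x)`_i.
Proof. by rewrite /decomposition; case: cid => p []. Qed.

Lemma decompositionK x : (decomposition x).[1] = x.
Proof. by rewrite /decomposition; case: cid => p []. Qed.

Lemma decomposition_unique p x : homogeneous_coefs p -> p.[1] = x ->
  decomposition x = p.
Proof.
move=> hp px; apply: homogeneous_coefs_inj => //; first exact: decomposition_gcomp.
by rewrite decompositionK.
Qed.

Lemma decomposition_zmod : zmod_morphism decomposition.
Proof.
move=> x y; apply: decomposition_unique => [i|].
  by rewrite coefB; apply: gcompB; apply: decomposition_gcomp.
by rewrite hornerD hornerN !decompositionK.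
Qed.

Lemma decomposition_monoid : monoid_morphism decomposition.
Proof.
split=> [|x y]; (apply: decomposition_unique; first move=> i).
- rewrite coef1; case: i => [|i] /=; [exact: gcomp1|exact: gcomp0].
- by rewrite hornerC.
- rewrite coefM; apply: (big_ind (gcomp i)) => [|u v|j _]; first exact: gcomp0.
    exact: gcompD.
  by rewrite -{1}(subnKC (leq_ord j)); apply: gcompM; apply: decomposition_gcomp.
- by rewrite hornerM !decompositionK.
Qed.

HB.instance Definition _ :=
  GRing.isZmodMorphism.Build G {poly G} decomposition decomposition_zmod.
HB.instance Definition _ :=
  GRing.isMonoidMorphism.Build G {poly G} decomposition decomposition_monoid.

Lemma decomposition_homogeneous i x : gcomp i x -> decomposition x = x *: 'X^i.
Proof.
move=> xi; apply: decomposition_unique => [j|]; last first.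
  by rewrite hornerZ hornerXn expr1n mulr1.
rewrite coefZ coefXn; case: eqP => [->|_]; first by rewrite mulr1.
by rewrite mulr0; apply: gcomp0.
Qed.

Lemma decomposition_sum x n : (size (decomposition x) <= n)%N ->
  x = \sum_(i < n) (decomposition x)`_i.
Proof.
move=> le; rewrite -[LHS]decompositionK (horner_coef_wide _ le).
by apply: eq_bigr => i _; rewrite expr1n mulr1.
Qed.

Lemma aug_decomposition x : aug G x = aug G (decomposition x)`_0.
Proof.
rewrite {1}(@decomposition_sum x _ (leqnSn _)).
by rewrite (aug_sum _ (decomposition_gcomp x)).
Qed.

Lemma aug_eq0_decomposition x : aug G x = 0 <-> (decomposition x)`_0 = 0.
Proof.
rewrite aug_decomposition; split=> [x0|->]; last by rewrite rmorph0.
have [z [_ zU]] := aug_bij0 G 0.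
rewrite -(zU _ (conj (decomposition_gcomp x 0) x0)); apply: zU.
by split; [apply: gcomp0|rewrite rmorph0].
Qed.

Lemma aug_irrelevant_ideal x : aug G x = 0 -> @irrelevant_ideal k G x.
Proof.
move=> /aug_eq0_decomposition x0; exists (size (decomposition x)).
exists (fun i => (decomposition x)`_i.+1).
split=> [i|]; first exact: decomposition_gcomp.
by rewrite {1}(@decomposition_sum x _ (leqnSn _)) big_ord_recl x0 add0r.
Qed.

End GradedDecomposition.

(** * Local rings isomorphic to a standard graded algebra *)

Section StandardGraded.
Variables (k : fieldType) (T : localRing k) (G : gradedAlgebra k).
Variable e : {rmorphism T -> G}.
Hypotheses (bij_e : bijective e) (stdG : standard_graded_algebra G).
Local Notation m := (maxideal T).

Lemma isom_surj y : exists x, e x = y.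
Proof. by have [g _ gK] := bij_e; exists (g y). Qed.

(** [e] is only a ring isomorphism, so its compatibility with residues needs proof. If [x] is in m
    but aug (e x) is nonzero, some [y] with [e y] of degree 0 makes 1 - x y a unit of [T] whose
    image has augmentation 0. Conversely, elements outside m are units. *)
Lemma isom_maxideal x : m x <-> aug G (e x) = 0.
Proof.
have augN1 u v : u * v = 1 -> aug G (e v) <> 0.
  move=> /(congr1 (fun z => aug G (e z))); rewrite !rmorphM !rmorph1 => uv v0.
  by move/eqP: uv; rewrite v0 mulr0 eq_sym (negbTE (oner_neq0 _)).
split=> [mx|ex]; last first.
  by apply: contrapT => /eqP/res_unit[y /augN1].
apply: contrapT => /eqP ex.
have [g [[_ gc] _]] := aug_bij0 G (aug G (e x))^-1; have [y ey] := isom_surj g.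
have /eqP/res_unit[u /augN1] : res T (1 - x * y) <> 0.
  by rewrite rmorphB rmorphM (mx : res T x = 0) mul0r subr0 rmorph1; apply/eqP/oner_neq0.
by rewrite !(rmorphB, rmorphM, rmorph1) ey gc divff // subrr.
Qed.

Lemma isom_pow_coef i x : ideal_pow m i x ->
  forall j, (j < i)%N -> (decomposition (e x))`_j = 0.
Proof.
elim: i x => [|i IH] x //.
move=> /(_ [set x | forall j, (j < i.+1)%N -> (decomposition (e x))`_j = 0]).
apply.
  split=> [j _|u v hu hv j ji|a u hu j ji] /=; first by rewrite !rmorph0 coef0.
    by rewrite !rmorphD coefD hu // hv // addr0.
  rewrite !rmorphM coefM big1 // => l _.
  by rewrite hu ?mulr0 //; apply: leq_ltn_trans ji; apply: leq_subr.
move=> _ [a [b [Ia /isom_maxideal/aug_eq0_decomposition b0 ->]]] /= j ji.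
rewrite !rmorphM coefM big1 // => l _; have [lj|jl] := ltnP l j.
  by rewrite IH ?mul0r //; apply: leq_trans lj _.
by rewrite (_ : j - l = 0)%N ?b0 ?mulr0 //; apply/eqP; rewrite subn_eq0.
Qed.

(** Generation in degree 1 enters here: an element of degree i+1 is a combination of elements of
    G_1, whose coefficients may be replaced by their components of degree i; these come from m^i by
    induction. *)
Lemma isom_gcomp_pow i x : gcomp i (e x) -> ideal_pow m i x.
Proof.
elim: i x => [|i IH] x // ex.
have : @irrelevant_ideal k G (e x).
  by apply: aug_irrelevant_ideal; apply: aug_gt0 ex.
rewrite stdG => /ideal_gen_sum[s [s1 exs]].
have : e x = \sum_(u <- s) (decomposition u.1)`_i * u.2.
  have := congr1 (fun y => (decomposition y)`_i.+1) exs.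
  rewrite (decomposition_homogeneous ex) coefZ coefXn eqxx mulr1 => ->.
  rewrite rmorph_sum coef_sum !big_seq; apply: eq_bigr => u /s1 u1.
  by rewrite rmorphM /= (decomposition_homogeneous u1) -scalerAr coefZ coefMX mulrC.
have [g eK gK] := bij_e; move=> /(congr1 g); rewrite eK => ->.
suff : exists y, ideal_pow m i.+1 y /\ e y = \sum_(u <- s) (decomposition u.1)`_i * u.2.
  by move=> [y [my <-]]; rewrite eK.
have [I0 ID _] := ideal_pow_ideal m i.+1.
rewrite big_seq.
apply: (big_ind (fun w => exists y, ideal_pow m i.+1 y /\ e y = w)).
- by exists 0; rewrite rmorph0.
- move=> _ _ [u [mu <-]] [v [mv <-]]; exists (u + v).
  by rewrite rmorphD; split=> //; apply: ID.
- move=> u /s1 u1; exists (g (decomposition u.1)`_i * g u.2).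
  rewrite rmorphM !gK; split=> //; apply: sub_ideal_gen.
  exists (g (decomposition u.1)`_i), (g u.2); split=> //.
    by apply: IH; rewrite gK; apply: decomposition_gcomp.
  by apply/isom_maxideal; rewrite gK; apply: aug_gt0 u1.
Qed.

(** Each component of degree j >= i comes from m^j, contained in m^i. With [isom_pow_coef], this
    identifies m^i with the part of [G] in degrees at least i. *)
Lemma isom_coef_pow i x : (forall j, (j < i)%N -> (decomposition (e x))`_j = 0) ->
  ideal_pow m i x.
Proof.
move=> x0; have [g eK gK] := bij_e.
have -> : x = \sum_(j < size (decomposition (e x))) g (decomposition (e x))`_j.
  apply: (can_inj eK); rewrite {1}(decomposition_sum (leqnn (size (decomposition (e x))))).
  by rewrite rmorph_sum; apply: eq_bigr => j _; rewrite gK.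
apply: ideal_sum => [|j _]; first exact: ideal_pow_ideal.
have [ji|ij] := ltnP j i.
  by rewrite x0 // -(rmorph0 e) eK; case: (ideal_pow_ideal m i).
apply: ideal_pow_le ij _ _; apply: isom_gcomp_pow; rewrite gK.
exact: decomposition_gcomp.
Qed.

(* The initial form of x is killed by G_1, hence lies in the socle. *)
Lemma isom_initial_form i r x : (i.+1 < r)%N -> socle T `<=` ideal_pow m r ->
  ideal_pow m i x -> (forall y, m y -> ideal_pow m r (x * y)) ->
  ideal_pow m i.+1 x.
Proof.
move=> ir socr mx xm.
have [z ez] := isom_surj (decomposition (e x))`_i.
have zi : gcomp i (e z) by rewrite ez; apply: decomposition_gcomp.
suff /socr/isom_pow_coef mz : socle T z.
  apply: isom_coef_pow => j; rewrite ltnS leq_eqVlt => /orP[/eqP ->|ji].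
    have := mz i (ltnW ir).
    by rewrite (decomposition_homogeneous zi) coefZ coefXn eqxx mulr1 ez.
  exact: isom_pow_coef mx _ ji.
have [g eK gK] := bij_e => y /isom_maxideal/aug_irrelevant_ideal.
rewrite stdG => /(_ [set w | e z * w = 0]) h.
apply: (can_inj eK); rewrite rmorphM rmorph0; apply: h.
  split=> [|u v /= zu zv|a u /= zu]; first by rewrite /= mulr0.
    by rewrite mulrDr zu zv addr0.
  by rewrite mulrCA zu mulr0.
move=> w w1 /=; have [v ev] := isom_surj w.
have mv : m v by apply/isom_maxideal; rewrite ev; apply: aug_gt0 w1.
(* The component of degree i+1 of e x times [w] is e z times [w]; it vanishes because x v lies in
   m^r and i+1 < r. *)
have := isom_pow_coef (xm _ mv) ir.
by rewrite !rmorphM /= ev (decomposition_homogeneous w1) -scalerAr coefZ coefMX /= mulrC -ez.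
Qed.

End StandardGraded.

(* The square P -> R, S together with P -> Q, presented so that R and S play
   symmetric roles; c ranges over P since its action on the socle generators
   only depends on its residue. *)
Record csum_diagram (k : fieldType) (R S P Q : localRing k) (dR : R) (dS : S)
    (p : {rmorphism P -> R}) (p' : {rmorphism P -> S}) (q : {rmorphism P -> Q})
    : Prop := CsumDiagram {
  csum_resl : forall z, res R (p z) = res P z;
  csum_resr : forall z, res S (p' z) = res P z;
  csum_resq : forall z, res Q (q z) = res P z;
  csum_inj : forall z, p z = 0 -> p' z = 0 -> z = 0;
  csum_pair : forall a b, res R a = res S b -> exists z, p z = a /\ p' z = b;
  csum_surj : forall y, exists z, q z = y;
  csum_ker : forall z, q z = 0 <-> exists c, p z = p c * dR /\ p' z = - (p' c * dS)
}.

(** Exchanging the factors changes the sign of the relation, hence the witness - c. This carries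
    statements about [R] over to [S] and reduces the theorem to ll(S) < ll(R). *)
Lemma csum_diagram_sym (k : fieldType) (R S P Q : localRing k) (dR : R) (dS : S)
    (p : {rmorphism P -> R}) (p' : {rmorphism P -> S}) (q : {rmorphism P -> Q}) :
  csum_diagram dR dS p p' q -> csum_diagram dS dR p' p q.
Proof.
case=> Hl Hr Hq Hi Hp Hs Hk; split=> //.
- by move=> z *; apply: Hi.
- by move=> b a ab; have [z [? ?]] := Hp a b (esym ab); exists z.
- move=> z; rewrite Hk; split=> -[c [e e']]; exists (- c);
    by rewrite !rmorphN !mulNr e e' ?opprK.
Qed.

(** * Powers of the maximal ideals and the socle of a connected sum *)

Section CsumPowers.
Variables (k : fieldType) (R S P Q : localRing k) (dR : R) (dS : S).
Variables (p : {rmorphism P -> R}) (p' : {rmorphism P -> S}) (q : {rmorphism P -> Q}).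
Hypothesis D : csum_diagram dR dS p p' q.

(** Pairs (a, 0) with a in m_R lie in m_P and are stable under products. The exponent starts at 1
    since (1, 0) is not in the fibre product. *)
Lemma csum_inl_pow i a : ideal_pow (maxideal R) i.+1 a ->
  exists z, [/\ ideal_pow (maxideal P) i.+1 z, p z = a & p' z = 0].
Proof.
have inl1 b : maxideal R b -> exists z, [/\ maxideal P z, p z = b & p' z = 0].
  move=> mb; have [|z [zb z0]] := csum_pair D (a := b) (b := 0).
    by rewrite rmorph0.
  by exists z; split=> //; rewrite /maxideal /= -(csum_resl D) zb.
elim: i a => [|i IH] a; first by rewrite !maxideal_pow1; apply: inl1.
move=> /(_ [set a | exists z,
  [/\ ideal_pow (maxideal P) i.+2 z, p z = a & p' z = 0]]); apply.
  have [P0 PD PM] := ideal_pow_ideal (maxideal P) i.+2.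
  split=> [|_ _ [u [mu <- u0]] [v [mv <- v0]]|b _ [u [mu <- u0]]].
  - by exists 0; rewrite !rmorph0.
  - by exists (u + v); rewrite !rmorphD u0 v0 addr0; split=> //; apply: PD.
  - have [s sb] := res_surj S (res R b).
    have [c [cb _]] := csum_pair D (esym sb).
    by exists (c * u); rewrite !rmorphM cb u0 mulr0; split=> //; apply: PM.
move=> _ [u [v [/IH[z [mz zu z0]] /inl1[w [mw wv w0]] ->]]].
exists (z * w); rewrite !rmorphM zu wv z0 mul0r; split=> //.
by apply: sub_ideal_gen; exists z, w.
Qed.

End CsumPowers.

Section CsumDiagram.
Variables (k : fieldType) (R S P Q : localRing k) (dR : R) (dS : S).
Variables (p : {rmorphism P -> R}) (p' : {rmorphism P -> S}) (q : {rmorphism P -> Q}).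
Hypothesis D : csum_diagram dR dS p p' q.
Hypotheses (socR : socle R = ideal_gen [set dR]) (dR0 : dR <> 0).
Hypotheses (socS : socle S = ideal_gen [set dS]) (dS0 : dS <> 0).
Hypotheses (dRm : maxideal R dR) (dSm : maxideal S dS).
Hypotheses (artR : artinian R) (artS : artinian S).
Hypothesis ltSR : (loewy_length S < loewy_length R)%N.

Local Notation r := (loewy_length R).
Local Notation s := (loewy_length S).
Local Notation mR := (ideal_pow (maxideal R)).
Local Notation mS := (ideal_pow (maxideal S)).
Local Notation mP := (ideal_pow (maxideal P)).
Local Notation mQ := (ideal_pow (maxideal Q)).

(** The element [z] is the sum of (p z, 0) and (0, p' z), both covered by [csum_inl_pow]. *)
Lemma csum_pow i z : mR i.+1 (p z) -> mS i.+1 (p' z) -> mP i.+1 z.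
Proof.
move=> /(csum_inl_pow D)[u [mu up u0]] /(csum_inl_pow (csum_diagram_sym D))[v [mv vp v0]].
have -> : z = u + v.
  apply/eqP; rewrite -subr_eq0; apply/eqP/(csum_inj D).
    by rewrite rmorphB rmorphD up v0 addr0 subrr.
  by rewrite rmorphB rmorphD vp u0 add0r subrr.
by case: (ideal_pow_ideal (maxideal P) i.+1) => _ PD _; apply: PD.
Qed.

Lemma csum_lift_socle c :
  exists z, [/\ p z = p c * dR, p' z = - (p' c * dS) & q z = 0].
Proof.
have [|z [za zb]] := csum_pair D (a := p c * dR) (b := - (p' c * dS)).
  rewrite rmorphN !rmorphM (dRm : res R _ = 0) (dSm : res S _ = 0).
  by rewrite !mulr0 oppr0.
by exists z; split=> //; apply/(csum_ker D); exists c.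
Qed.

Lemma csum_surjl a : exists c, p c = a.
Proof.
have [b ab] := res_surj S (res R a).
by have [c [ca _]] := csum_pair D (esym ab); exists c.
Qed.

Lemma csum_surjr b : exists c, p' c = b.
Proof.
have [a ab] := res_surj R (res S b).
by have [c [_ cb]] := csum_pair D ab; exists c.
Qed.

(** Both products depend only on the common residue of p c and p' c. *)
Lemma csum_ker_res0 c : p' c * dS = 0 -> p c * dR = 0.
Proof.
move=> /(mul_socle_gen_eq0 dS0) mc; apply: (socle_gen_max socR).
by rewrite /maxideal /= (csum_resl D) -(csum_resr D).
Qed.

(** The right-hand side expresses vanishing in degree i of gr(R) and of gr(S / soc S). When i <= s,
    kernel elements have first coordinate in m_R^r, contained in m_R^(i+1), so only their multiple
    of [dS] matters. When i > s, the second coordinates are 0, and the kernel element involved is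
    then 0 as well. *)
Lemma csum_quot_pow i z : mP i z ->
  mQ i.+1 (q z) <-> mR i.+1 (p z) /\ exists t, mS i.+1 (p' z - t * dS).
Proof.
move=> mz.
have [R0 RD RM] := ideal_pow_ideal (maxideal R) i.+1.
have [S0 SD SM] := ideal_pow_ideal (maxideal S) i.+1.
have mS0 x : (s < i)%N -> mP i x -> p' x = 0.
  move=> si /(rmorph_maxideal_pow (csum_resr D)) mx.
  by apply: (loewy_top artS); apply: ideal_pow_le mx.
have mdR c : (i <= s)%N -> mR i.+1 (c * dR).
  move=> is_; apply: RM; apply: (ideal_pow_le (leq_ltn_trans is_ ltSR)).
  exact: socle_gen_loewy.
split.
  move=> /(surj_maxideal_pow (csum_resq D) (csum_surj D))[w [mw /eqP]].
  rewrite eq_sym -subr_eq0 -rmorphB => /eqP /(csum_ker D)[c []].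
  rewrite !rmorphB => /eqP; rewrite subr_eq => /eqP pz.
  move=> /eqP; rewrite subr_eq => /eqP p'z.
  have mRw := rmorph_maxideal_pow (csum_resl D) mw.
  have mSw := rmorph_maxideal_pow (csum_resr D) mw.
  have [is_|si] := leqP i s.
    split; first by rewrite pz; apply: RD => //; apply: mdR.
    by exists (- p' c); rewrite p'z mulNr opprK addrC addNKr.
  have pz0 := mS0 _ si mz; split; last by exists 0; rewrite pz0 mul0r subr0.
  rewrite pz csum_ker_res0 ?add0r //; apply/eqP; rewrite -oppr_eq0; apply/eqP.
  by move: p'z; rewrite pz0 (mS0 w) ?addr0 //; apply: ideal_powS.
move=> [mRz [t mSz]]; have [is_|si] := leqP i s; last first.
  apply: (rmorph_maxideal_pow (csum_resq D)); apply: csum_pow => //.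
  by rewrite mS0.
(* Adding a kernel element with p' c = t removes t dS without changing the image in [Q]; the added p
   c dR is already in m_R^(i+1). *)
have [c ct] := csum_surjr t; have [w [pw p'w qw]] := csum_lift_socle c.
rewrite -[q z]addr0 -qw -rmorphD; apply: (rmorph_maxideal_pow (csum_resq D)).
apply: csum_pow; rewrite rmorphD; last by rewrite p'w ct.
by rewrite pw; apply: RD => //; apply: mdR.
Qed.

(** Modulo the kernel, the multiple of [dS] is traded for one of [dR], which lies in m_R^r. *)
Lemma csum_socle_pow z u v : p z = u * dR -> p' z = v * dS -> mQ r (q z).
Proof.
move=> pz p'z; have [c cv] := csum_surjr v.
have [w [pw p'w qw]] := csum_lift_socle c.
rewrite -[q z]addr0 -qw -rmorphD; apply: (rmorph_maxideal_pow (csum_resq D)).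
have := socle_gen_loewy socR artR; case: (r) ltSR => // n _ mdR.
apply: csum_pow; rewrite rmorphD.
  by rewrite pz pw -mulrDl; case: (ideal_pow_ideal (maxideal R) n.+1) => _ _; apply.
by rewrite p'z p'w cv subrr; case: (ideal_pow_ideal (maxideal S) n.+1).
Qed.

(** Multiplying a lift [z] of a socle element by pairs (x, 0) with x in m_R gives kernel elements
    with second coordinate 0, hence 0. So p z is in soc R and, symmetrically, p' z is in soc S. *)
Lemma csum_socle : socle Q `<=` mQ r.
Proof.
move=> y; have [z <-] := csum_surj D y => zQ.
have zw w : maxideal P w -> exists c, p (z * w) = p c * dR /\ p' (z * w) = - (p' c * dS).
  move=> mw; apply/(csum_ker D); rewrite rmorphM; apply: zQ.
  by rewrite /maxideal /= (csum_resq D).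
have D' := csum_diagram_sym D.
have /(socleP socR)[u zu] : socle R (p z).
  move=> x; rewrite -{1}maxideal_pow1 => /(csum_inl_pow D)[w [mw <- w0]].
  have [|c []] := zw w; first by rewrite -maxideal_pow1.
  rewrite !rmorphM w0 mulr0 => -> /esym/eqP; rewrite oppr_eq0 => /eqP.
  exact: csum_ker_res0.
have /(socleP socS)[v zv] : socle S (p' z).
  move=> x; rewrite -{1}maxideal_pow1 => /(csum_inl_pow D')[w [mw <- w0]].
  have [|c []] := zw w; first by rewrite -maxideal_pow1.
  rewrite !rmorphM w0 mulr0 => /esym /(mul_socle_gen_eq0 dR0) mc ->.
  rewrite (socle_gen_max socS) ?oppr0 //.
  by rewrite /maxideal /= (csum_resr D) -(csum_resl D).
exact: csum_socle_pow zu zv.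
Qed.

Lemma csum_not_standard_graded : (2 <= s)%N -> ~ standard_graded Q.
Proof.
move=> s2 [G [stdG [e bij_e]]].
have [i si] : exists i, s = i.+2 by case: s s2 => [|[|i]] // _; exists i.
have [|b [mb nb]] := loewy_pow_strict socS dS0 artS (i := i.+1).
  by rewrite si.
have [z [mz zb z0]] := csum_inl_pow (csum_diagram_sym D) mb.
have /(csum_quot_pow mz)[_ [t]] : mQ i.+2 (q z).
  apply: (isom_initial_form bij_e stdG (r := r)); first by rewrite -si.
  - exact: csum_socle.
  - exact: (rmorph_maxideal_pow (csum_resq D) mz).
  move=> y; have [w <-] := csum_surj D y.
  rewrite /maxideal /= (csum_resq D) => mw.
  (* Here [z] is (0, b): its product with an element of m_P has second coordinate in m_S^s, hence in
     soc S, and first coordinate 0. *)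
  have /(loewy_socle artS)/(socleP socS)[v zv] : mS s (p' (z * w)).
    rewrite si rmorphM zb -[i.+2]addn1; apply: ideal_powM => //.
    by rewrite maxideal_pow1 /maxideal /= (csum_resr D).
  rewrite -rmorphM; apply: (csum_socle_pow (u := 0) _ zv).
  by rewrite rmorphM z0 !mul0r.
(* Membership holds only up to t dS, but [dS] is itself in m_S^s. *)
rewrite zb => mbt; apply: nb; rewrite -[b](subrK (t * dS)).
have [_ SD SM] := ideal_pow_ideal (maxideal S) i.+2; apply: SD => //.
by apply: SM; rewrite -si; apply: socle_gen_loewy.
Qed.

Lemma socle_gen_max_sub : ideal_gen [set dS] `<=` maxideal S.
Proof. by move=> x; apply; [exact: maxideal_ideal|move=> _ ->]. Qed.

Local Notation S' :=
  (quot_local (ideal_gen_ideal [set dS]) socle_gen_max_sub).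

(** The factors are gr(R) and gr(S / soc S). As A x_k k is A, excluding k makes the decomposition a
    genuine one; elements of m outside m^2 provide nonzero classes in degree 1, and they survive in
    S / soc S because [dS] is in m_S^2. *)
Lemma csum_assoc_graded : exists A B : gradedAlgebra k,
  graded_isom (assoc_graded Q) (fibprod_graded A B) /\
  ((2 <= r)%N -> (2 <= s)%N -> ~ ring_isom A k /\ ~ ring_isom B k).
Proof.
have [f [fres fsurj fker]] :=
  quot_localP (ideal_gen_ideal [set dS]) socle_gen_max_sub.
have fpow i b : ideal_pow (maxideal S') i.+1 (f b) <->
    exists t, mS i.+1 (b - t * dS).
  split=> [/(surj_maxideal_pow fres fsurj)[c [mc /eqP]]|[t mt]].
    rewrite eq_sym -subr_eq0 -rmorphB => /eqP /fker /ideal_gen1P[t bc].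
    by exists t; rewrite -bc opprB addrC subrK.
  have : f (t * dS) = 0 by apply/fker/ideal_gen1P; exists t.
  rewrite -[f b]subr0 => <-; rewrite -rmorphB.
  exact: (rmorph_maxideal_pow fres mt).
have fp'res z : res S' ((f \o p') z) = res P z.
  by rewrite /= -(csum_resr D); apply: fres.
exists (assoc_graded R), (assoc_graded S'); split.
  apply: (assoc_graded_fibprod (csum_resq D) (csum_resl D) fp'res (csum_surj D)).
    move=> i a b' ma /(surj_maxideal_pow fres fsurj)[b [mb <-]].
    rewrite fres => /(csum_pair D)[z [za zb]]; exists z.
    split=> //; last by rewrite /= zb.
    by case: i ma mb => // i; rewrite -za -zb; apply: csum_pow.
  by move=> i z /csum_quot_pow ->; rewrite -fpow.
move=> r2 s2; split.
  have [x [mx m2x]] := loewy_pow_strict socR dR0 artR (ltnW r2).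
  by apply: assoc_graded_not_field m2x; rewrite -maxideal_pow1.
have [x [mx m2x]] := loewy_pow_strict socS dS0 artS (ltnW s2).
apply: (@assoc_graded_not_field _ _ (f x)).
  by have : maxideal S x; [rewrite -maxideal_pow1 | rewrite /maxideal /= fres].
move=> /fpow[t mt]; apply: m2x; rewrite -[x](subrK (t * dS)).
have [_ SD SM] := ideal_pow_ideal (maxideal S) 2; apply: SD => //.
by apply: SM; apply: (ideal_pow_le s2); apply: socle_gen_loewy.
Qed.

End CsumDiagram.

Lemma ring_isom_standard_graded (k : fieldType) (T T' : localRing k) :
  ring_isom T T' -> standard_graded T' -> standard_graded T.
Proof.
move=> [f bij_f] [G [stdG [g bij_g]]]; exists G; split=> //.
by exists (g \o f : {rmorphism T -> G}); apply: bij_comp.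
Qed.

(** * The connected sum as an instance of the diagram, and the theorem *)

Section ConnectedSum.
Variables (k : fieldType) (R S : localRing k) (dR : R) (dS : S).
Hypotheses (nR : ~ ring_isom R k) (nS : ~ ring_isom S k).
Hypotheses (hR : socle R = ideal_gen [set dR])
           (hS : socle S = ideal_gen [set dS]).

(** The maps are the two projections and the quotient map; membership in the principal ideal, read
    on both coordinates, is the kernel condition. *)
Lemma connected_sum_diagram :
  exists (p : {rmorphism fibprod_local R S -> R})
         (p' : {rmorphism fibprod_local R S -> S})
         (q : {rmorphism fibprod_local R S -> connected_sum nR nS hR hS}),
    csum_diagram dR dS p p' q.
Proof.
have [q [qres qsurj qker]] := quot_localP
  (@ideal_gen_ideal (fibprod_local R S) _ : is_ideal (csum_ideal nR nS hR hS))
  (@csum_ideal_max k R S dR dS nR nS hR hS).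
exists (fst \o val : {rmorphism fibprod (res R) (res S) -> R}).
exists (snd \o val : {rmorphism fibprod (res R) (res S) -> S}), q.
split=> //.
- by move=> z; rewrite /= -fibprodP.
- by move=> z z1 z2; apply: val_inj; rewrite [LHS]surjective_pairing; congr (_, _).
- by move=> a b ab; exists (mk_fibprod ab).
move=> z; rewrite qker /csum_ideal ideal_gen1P; split=> -[c].
  by move=> ->; exists c; rewrite /= !subr0 sub0r mulrN.
move=> [z1 z2]; exists c; apply: val_inj; rewrite [LHS]surjective_pairing.
transitivity ((fibprod_val c).1 * (dR - 0), (fibprod_val c).2 * (0 - dS)); last by [].
by rewrite subr0 sub0r mulrN; congr (_, _).
Qed.

End ConnectedSum.

Theorem proposition2p1 (k : fieldType) (R S : localRing k)
  (artR : artinian R) (artS : artinian S)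
  (gorR : gorenstein R) (gorS : gorenstein S)
  (nR : ~ ring_isom R k) (nS : ~ ring_isom S k)
  (dR : R) (dS : S)
  (hR : socle R = ideal_gen (set1 dR)) (hS : socle S = ideal_gen (set1 dS))
  (neq_ll : loewy_length R <> loewy_length S) :
  let Q := connected_sum nR nS hR hS in
  (exists A B : gradedAlgebra k,
      graded_isom (assoc_graded Q) (fibprod_graded A B) /\
      ((2 <= loewy_length R)%N -> (2 <= loewy_length S)%N ->
        ~ ring_isom A k /\ ~ ring_isom B k)) /\
  (standard_graded R -> standard_graded S ->
   (2 <= loewy_length R)%N -> (2 <= loewy_length S)%N ->
   nontrivial_connected_sum nR nS hR hS /\ ~ standard_graded Q).
Proof.
have [p [p' [q D]]] := connected_sum_diagram nR nS hR hS.
have dR0 := socle_gen_neq0 gorR hR; have dS0 := socle_gen_neq0 gorS hS.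
have dRm : maxideal R dR := socle_maxideal nR hR.
have dSm : maxideal S dS := socle_maxideal nS hS.
move=> Q.
suff [grQ nstdQ] : (exists A B : gradedAlgebra k,
      graded_isom (assoc_graded Q) (fibprod_graded A B) /\
      ((2 <= loewy_length R)%N -> (2 <= loewy_length S)%N ->
        ~ ring_isom A k /\ ~ ring_isom B k)) /\
  ((2 <= loewy_length R)%N -> (2 <= loewy_length S)%N -> ~ standard_graded Q).
  split=> // stdR stdS r2 s2; have nstd := nstdQ r2 s2.
  by split=> //; split=> /ring_isom_standard_graded std; apply/nstd/std.
have [lt|gt|//] := ltngtP (loewy_length S) (loewy_length R); last by move=> e; case: neq_ll.
  split; first exact: (csum_assoc_graded D).
  by move=> r2 s2; apply: (csum_not_standard_graded D).
(* In the opposite order of Loewy lengths, the exchanged diagram applies. *)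
have D' := csum_diagram_sym D.
split; last by move=> r2 s2; apply: (csum_not_standard_graded D').
have [A [B [isoQ nAB]]] :=
  csum_assoc_graded D' hS dS0 hR dR0 dSm dRm artS artR gt.
by exists A, B; split=> // r2 s2; apply: nAB.
Qed.
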